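(* Let $A$ be a $4$-dimensional non-split non-Lie nilpotent Leibniz algebra over $\mathbb{C}$ with $\dim(A^2)=2=\dim(\mathrm{Leib}(A))$ and $\dim(A^3)=0$. Then $A$ is isomorphic to a Leibniz algebra spanned by $\{x_1,x_2,x_3,x_4\}$ (a basis) with the nonzero products given by one of the following: $\mathcal{A}_{14}$: $[x_1,x_1]=x_3,\ [x_1,x_2]=x_4$. $\mathcal{A}_{15}$: $[x_1,x_1]=x_3,\ [x_2,x_1]=x_4$. $\mathcal{A}_{16}$: $[x_1,x_2]=x_4,\ [x_2,x_1]=x_3,\ [x_2,x_2]=-x_3$. $\mathcal{A}_{17}$: $[x_1,x_1]=x_3,\ [x_1,x_2]=x_4,\ [x_2,x_1]=\alpha x_4$, for some $\alpha\in\mathbb{C}\setminus\{-1,0\}$. $\mathcal{A}_{18}$: $[x_1,x_1]=x_3,\ [x_2,x_1]=x_4,\ [x_1,x_2]=\alpha x_3,\ [x_2,x_2]=-x_4$, for some $\alpha\in\mathbb{C}\setminus\{-1\}$. $\mathcal{A}_{19}$: $[x_1,x_1]=x_3,\ [x_1,x_2]=x_3,\ [x_2,x_1]=x_3+x_4,\ [x_2,x_2]=x_4$.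
   Context: All algebras are over $\mathbb{C}$. A (left) Leibniz algebra is a $\mathbb{C}$-vector space $A$ with a bilinear product $[\,,\,]:A\times A\to A$ such that every left multiplication operator is a derivation, i.e. $[a,[b,c]]=[[a,b],c]+[b,[a,c]]$ for all $a,b,c\in A$. Put $A^1=A$ and $A^i=[A,A^{i-1}]$ (the span of the products) for $i\ge 2$; $A$ is nilpotent if $A^{c+1}=0$ for some positive integer $c$. $\mathrm{Leib}(A)=\mathrm{span}\{[a,a]\mid a\in A\}$; $A$ is a Lie algebra if and only if $\mathrm{Leib}(A)=0$, and ''non-Lie'' means $\mathrm{Leib}(A)\ne 0$. $A$ is split if it is a direct sum of two nontrivial ideals, and non-split otherwise. Products of basis elements not listed are zero. *)

(* Defs.v *)
From HB Require Import structures.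
From mathcomp Require Import all_boot all_order all_algebra sesquilinear.
From mathcomp Require Import boolp classical_sets reals complex.

Set Implicit Arguments.
Unset Strict Implicit.
Unset Printing Implicit Defensive.

Import Order.TTheory GRing.Theory Num.Theory.

Local Open Scope classical_set_scope.
Local Open Scope ring_scope.

(* Left Leibniz algebras on finite-dimensional spaces. *)
HB.mixin Record isLeibniz (F : fieldType) (A : Type) of Vector F A := {
  br : A -> A -> A;
  br_bilinear : bilinear_for ( *:%R : F -> A -> A) ( *:%R : F -> A -> A) br;
  br_leibniz : forall a b c : A, br a (br b c) = br (br a b) c + br b (br a c)
}.

#[short(type="leibnizType")]
HB.structure Definition Leibniz (F : fieldType) :=
  { A of isLeibniz F A & Vector F A }.

Definition is_vspan (F : fieldType) (V : vectType F) (S : set V)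
    (U : {vspace V}) : Prop :=
  (forall v, S v -> v \in U) /\
  (forall W : {vspace V}, (forall v, S v -> v \in W) -> (U <= W)%VS).

(* The linear span of an arbitrary subset; the default 0%VS is never used,
   by vspanP. *)
Definition vspan (F : fieldType) (V : vectType F) (S : set V) : {vspace V} :=
  xget 0%VS [set U | is_vspan S U].

Lemma vspanP (F : fieldType) (V : vectType F) (S : set V) :
  is_vspan S (vspan S).
Proof.
rewrite /vspan; case: xgetP => [U _ //|noU].
pose P n := `[< exists2 U : {vspace V}, \dim U = n & forall v, S v -> v \in U >].
have exP : exists n, P n.
  by exists (\dim {:V}); apply/asboolP; exists fullv => // v _; rewrite memvf.
case: (ex_minnP exP) => n /asboolP[U dimU SU] minU.
case: (noU U); split=> // W SW.
have le_n : (n <= \dim (U :&: W))%N.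
  apply: minU; apply/asboolP; exists (U :&: W)%VS => // v Sv.
  by rewrite memv_cap SU ?SW.
have /eqP <- : (U :&: W)%VS == U by rewrite eqEdim capvSl dimU.
exact: capvSr.
Qed.

Definition br_vs (F : fieldType) (A : leibnizType F) (U V : {vspace A}) :
    {vspace A} :=
  vspan [set c | exists a b, [/\ a \in U, b \in V & c = br a b]].

(* lpow A i is A^i, for i >= 1 (lpow A 0 is junk, equal to A^1). *)
Definition lpow (F : fieldType) (A : leibnizType F) (i : nat) : {vspace A} :=
  iter i.-1 (fun U : {vspace A} => br_vs fullv U) fullv.

Definition nilpotent_alg (F : fieldType) (A : leibnizType F) : Prop :=
  exists2 c : nat, (0 < c)%N & lpow A c.+1 = 0%VS.

Definition Leib (F : fieldType) (A : leibnizType F) : {vspace A} :=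
  vspan (range (fun a : A => br a a)).

Definition non_Lie (F : fieldType) (A : leibnizType F) : Prop :=
  Leib A <> 0%VS.

Definition is_ideal (F : fieldType) (A : leibnizType F) (I : {vspace A}) :
    Prop :=
  forall a u : A, u \in I -> br a u \in I /\ br u a \in I.

Definition split_alg (F : fieldType) (A : leibnizType F) : Prop :=
  exists I J : {vspace A},
    [/\ is_ideal I, is_ideal J, I <> 0%VS, J <> 0%VS &
        (I + J = fullv)%VS /\ (I :&: J = 0)%VS].

Definition leib_iso (F : fieldType) (A B : leibnizType F) : Prop :=
  exists f : {linear A -> B},
    bijective f /\ forall a b : A, f (br a b) = br (f a) (f b).

(* Algebras of dimension 4 given by a multiplication table: t i j is the
   product [x_i, x_j] for 1 <= i, j <= 4, where x_1, ..., x_4 is the standard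
   basis of F^4. *)
Definition x_ (F : fieldType) (k : nat) : 'rV[F]_4 := \row_(j < 4) (j.+1 == k)%:R.

Definition table (F : fieldType) := nat -> nat -> 'rV[F]_4.

Definition tmul (F : fieldType) (t : table F) (u v : 'rV[F]_4) : 'rV[F]_4 :=
  \sum_(i < 4) \sum_(j < 4) (u 0 i * v 0 j) *: t i.+1 j.+1.

Definition tleibniz (F : fieldType) (t : table F) : Prop :=
  forall a b c, tmul t a (tmul t b c) =
                tmul t (tmul t a b) c + tmul t b (tmul t a c).

Lemma tmul_bilinear (F : fieldType) (t : table F) :
  bilinear_for ( *:%R : F -> 'rV[F]_4 -> 'rV[F]_4) *:%R (tmul t).
Proof.
split=> [v|u] k a b /=; rewrite /tmul scaler_sumr -big_split /=;
  apply: eq_bigr => i _; rewrite scaler_sumr -big_split /=;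
  apply: eq_bigr => j _; rewrite !mxE scalerA -scalerDl; congr (_ *: _).
- by rewrite mulrDl mulrA.
- by rewrite mulrDr mulrCA.
Qed.

Lemma tmul_x (F : fieldType) (t : table F) (i j : nat) :
  (0 < i <= 4)%N -> (0 < j <= 4)%N -> tmul t (x_ F i) (x_ F j) = t i j.
Proof.
case: i j => [|i] [|j] //= lti ltj.
rewrite /tmul (bigD1 (Ordinal lti)) //= (bigD1 (Ordinal ltj)) //= !mxE !eqxx.
rewrite mulr1 scale1r big1 ?addr0 => [|k nek]; last first.
  by rewrite !mxE eqSS (negPf (nek : (k : nat) != j)) mulr0 scale0r.
rewrite big1 ?addr0 // => k nek; apply: big1 => l _.
by rewrite !mxE eqSS (negPf (nek : (k : nat) != i)) mul0r scale0r.
Qed.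

Definition table_alg (F : fieldType) (t : table F) (ht : tleibniz t) : Type :=
  'rV[F]_4.

HB.instance Definition _ (F : fieldType) (t : table F) (ht : tleibniz t) :=
  Vector.on (table_alg ht).
HB.instance Definition _ (F : fieldType) (t : table F) (ht : tleibniz t) :=
  isLeibniz.Build F (table_alg ht) (tmul_bilinear t) ht.

(* A table is Leibniz if [x_i, x_j] = 0 unless i, j <= 2 and all products lie
   in the span of x_3 and x_4: then all triple products vanish. *)
Lemma tleibniz_class2 (F : fieldType) (t : table F) :
  (forall i j, (2 < i)%N || (2 < j)%N -> t i j = 0) ->
  (forall i j (k : 'I_4), (k < 2)%N -> t i j 0 k = 0) -> tleibniz t.
Proof.
move=> t0 tk.
have mk (a b : 'rV[F]_4) (k : 'I_4) : (k < 2)%N -> tmul t a b 0 k = 0.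
  move=> ltk; rewrite summxE big1 // => i _; rewrite summxE big1 // => j _.
  by rewrite mxE tk ?mulr0.
have m0 (a b : 'rV[F]_4) : (forall k : 'I_4, (k < 2)%N -> a 0 k = 0) ->
    tmul t a b = 0 /\ tmul t b a = 0.
  move=> a0; split; apply: big1 => i _; apply: big1 => j _.
  - have [lei|lti] := ltnP i 2; first by rewrite a0 // mul0r scale0r.
    by rewrite t0 ?scaler0 // ltnS lti.
  - have [lej|ltj] := ltnP j 2; first by rewrite a0 // mulr0 scale0r.
    by rewrite t0 ?scaler0 // !ltnS ltj orbT.
move=> a b c.
by rewrite (m0 _ a (mk b c)).2 (m0 _ c (mk a b)).1 (m0 _ b (mk a c)).2 addr0.
Qed.

Definition t14 (F : fieldType) : table F := fun i j =>
  match i, j with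
  | 1, 1 => x_ F 3
  | 1, 2 => x_ F 4
  | _, _ => 0%R
  end%N.

Definition t15 (F : fieldType) : table F := fun i j =>
  match i, j with
  | 1, 1 => x_ F 3
  | 2, 1 => x_ F 4
  | _, _ => 0%R
  end%N.

Definition t16 (F : fieldType) : table F := fun i j =>
  match i, j with
  | 1, 2 => x_ F 4
  | 2, 1 => x_ F 3
  | 2, 2 => (- x_ F 3)%R
  | _, _ => 0%R
  end%N.

Definition t17 (F : fieldType) (alpha : F) : table F := fun i j =>
  match i, j with
  | 1, 1 => x_ F 3
  | 1, 2 => x_ F 4
  | 2, 1 => (alpha *: x_ F 4)%R
  | _, _ => 0%R
  end%N.

Definition t18 (F : fieldType) (alpha : F) : table F := fun i j =>
  match i, j with
  | 1, 1 => x_ F 3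
  | 2, 1 => x_ F 4
  | 1, 2 => (alpha *: x_ F 3)%R
  | 2, 2 => (- x_ F 4)%R
  | _, _ => 0%R
  end%N.

Definition t19 (F : fieldType) : table F := fun i j =>
  match i, j with
  | 1, 1 => x_ F 3
  | 1, 2 => x_ F 3
  | 2, 1 => (x_ F 3 + x_ F 4)%R
  | 2, 2 => x_ F 4
  | _, _ => 0%R
  end%N.

Local Ltac class2_table :=
  apply: tleibniz_class2 => [[|[|[|i]]] [|[|[|j]]] //|];
  move=> [|[|[|i]]] [|[|[|j]]] [[|[|k]] ltk] //= _;
  by rewrite !mxE /= ?mulr0 ?oppr0 ?addr0.

Fact t14_leibniz (F : fieldType) : tleibniz (t14 F).
Proof. by class2_table. Qed.
Fact t15_leibniz (F : fieldType) : tleibniz (t15 F).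
Proof. by class2_table. Qed.
Fact t16_leibniz (F : fieldType) : tleibniz (t16 F).
Proof. by class2_table. Qed.
Fact t17_leibniz (F : fieldType) (alpha : F) : tleibniz (t17 alpha).
Proof. by class2_table. Qed.
Fact t18_leibniz (F : fieldType) (alpha : F) : tleibniz (t18 alpha).
Proof. by class2_table. Qed.
Fact t19_leibniz (F : fieldType) : tleibniz (t19 F).
Proof. by class2_table. Qed.

Definition A14 (F : fieldType) : leibnizType F := table_alg (@t14_leibniz F).
Definition A15 (F : fieldType) : leibnizType F := table_alg (@t15_leibniz F).
Definition A16 (F : fieldType) : leibnizType F := table_alg (@t16_leibniz F).
Definition A17 (F : fieldType) (alpha : F) : leibnizType F :=
  table_alg (t17_leibniz alpha).
Definition A18 (F : fieldType) (alpha : F) : leibnizType F :=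
  table_alg (t18_leibniz alpha).
Definition A19 (F : fieldType) : leibnizType F := table_alg (@t19_leibniz F).

(* Main.v *)
From HB Require Import structures.
Require Import Defs.
From mathcomp Require Import all_boot all_order all_algebra.
From mathcomp Require Import reals complex.
From mathcomp Require Import ring.

(** Let W = A^2.  Since Leib(A) is contained in W and has the same dimension,
the two are equal, and W is central: A^3 = 0 kills the products [a, w], and
the Leibniz identity rewrites [[a, b], c] as [a, [b, c]] - [b, [a, c]], which
is 0 as well.  So A is determined by a bilinear map V x V -> W, where V = A/W
is a plane, and the task is to classify such maps up to changes of basis of V
and of W.  That Leib(A) = W says that the squares [a, a] span W.

For generators e1, e2 of A modulo W, the three vectors [e1, e1],
[e1, e2] + [e2, e1], [e2, e2] span the plane W, so they satisfy exactly one
linear relation up to scaling, with coefficients x, y, z say.  A change of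
basis of V acts on it as on the binary quadratic form x S^2 + 2y ST + z T^2,
which splits into two linear factors over the complex numbers
([special_pair]).

- If the factors are proportional, some basis has [e2, e2] = 0.  The products
  are then determined by the coordinates (s, r) of [e1, e2] on
  w1 = [e1, e1] and w2 = [e1, e2] + [e2, e1]; when s = 0 a rescaling gives
  A_14, A_15 or A_17, and otherwise replacing e1 by a suitable e1 + c e2 gives
  A_16 ([classified_null_vector]).

- If they are independent, some basis has [e1, e2] = - [e2, e1].  Put
  w1 = [e1, e1], w2 = [e2, e2] and [e1, e2] = p w1 + q w2.  The remaining
  freedom is rescaling (and exchanging) e1 and e2, under which the product pq
  is invariant.  When p = q = 0 the algebra is the direct sum of the ideals
  spanned by e1, w1 and by e2, w2, which is excluded.  Otherwise a rescaling
  achieves q = p + 1, and the algebra is A_18 with alpha = 4pq, except when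
  4pq = -1, the value at which the two lines spanned by the anticommuting pair
  of A_18 coincide; the algebra is then A_19 ([classified_anticommuting]).

The argument works over any field of characteristic other than 2 in which
every element is a square. *)

Set Implicit Arguments.
Unset Strict Implicit.
Unset Printing Implicit Defensive.

Import GRing.Theory Num.Theory.

Local Open Scope ring_scope.

(** * Bilinearity and coordinates on two vectors *)

Lemma brDl (F : fieldType) (A : leibnizType F) (a b c : A) :
  br (a + b) c = br a c + br b c.
Proof. by have /= := (@br_bilinear F A).1 c 1 a b; rewrite !scale1r. Qed.

Lemma brDr (F : fieldType) (A : leibnizType F) (a b c : A) :
  br a (b + c) = br a b + br a c.
Proof. by have /= := (@br_bilinear F A).2 a 1 b c; rewrite !scale1r. Qed.

Lemma br0l (F : fieldType) (A : leibnizType F) (a : A) : br 0 a = 0.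
Proof. by apply: (addrI (br 0 a)); rewrite -brDl !addr0. Qed.

Lemma br0r (F : fieldType) (A : leibnizType F) (a : A) : br a 0 = 0.
Proof. by apply: (addrI (br a 0)); rewrite -brDr !addr0. Qed.

Lemma brZl (F : fieldType) (A : leibnizType F) k (a b : A) :
  br (k *: a) b = k *: br a b.
Proof. by have /= := (@br_bilinear F A).1 b k a 0; rewrite br0l !addr0. Qed.

Lemma brZr (F : fieldType) (A : leibnizType F) k (a b : A) :
  br a (k *: b) = k *: br a b.
Proof. by have /= := (@br_bilinear F A).2 a k b 0; rewrite br0r !addr0. Qed.

(** Every vector of the computations below is kept in the form [lc u v a b],
so that an identity between vectors is settled by identities between two
pairs of scalars. *)
Definition lc (F : fieldType) (V : lmodType F) (u v : V) (a b : F) : V :=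
  a *: u + b *: v.

Lemma lcD (F : fieldType) (V : lmodType F) (u v : V) a b c d :
  lc u v a b + lc u v c d = lc u v (a + c) (b + d).
Proof. by rewrite /lc addrACA -!scalerDl. Qed.

Lemma lcZ (F : fieldType) (V : lmodType F) (u v : V) k a b :
  k *: lc u v a b = lc u v (k * a) (k * b).
Proof. by rewrite /lc scalerDr !scalerA. Qed.

Lemma lcN (F : fieldType) (V : lmodType F) (u v : V) a b :
  - lc u v a b = lc u v (- a) (- b).
Proof. by rewrite /lc opprD !scaleNr. Qed.

Lemma lc10 (F : fieldType) (V : lmodType F) (u v : V) : lc u v 1 0 = u.
Proof. by rewrite /lc scale1r scale0r addr0. Qed.

Lemma lc01 (F : fieldType) (V : lmodType F) (u v : V) : lc u v 0 1 = v.
Proof. by rewrite /lc scale1r scale0r add0r. Qed.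

Lemma lc00 (F : fieldType) (V : lmodType F) (u v : V) : lc u v 0 0 = 0.
Proof. by rewrite /lc !scale0r addr0. Qed.

Lemma br_lc (F : fieldType) (A : leibnizType F) (u v : A) a b c d :
  br (lc u v a b) (lc u v c d) =
  (a * c) *: br u u + (a * d) *: br u v + (b * c) *: br v u
  + (b * d) *: br v v.
Proof.
rewrite /lc !brDl !brDr !brZl !brZr !scalerA !addrA.
by rewrite (mulrC a) (mulrC a) (mulrC b) (mulrC b).
Qed.

(** Cramer's rule, used to see that an invertible change of two vectors does
not change their span. *)
Lemma mem_lc2 (F : fieldType) (V : vectType F) (U : {vspace V}) (u v : V)
    a b c d :
  a * d - b * c != 0 -> lc u v a b \in U -> lc u v c d \in U ->
  u \in U /\ v \in U.
Proof.
move=> D0 Uab Ucd; split.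
- have -> : u = (a * d - b * c)^-1 *: (d *: lc u v a b - b *: lc u v c d).
    rewrite !lcZ lcN lcD lcZ -{1}(lc10 u v); congr lc; field; exact: D0.
  by rewrite memvZ // memvB // memvZ.
- have -> : v = (a * d - b * c)^-1 *: (a *: lc u v c d - c *: lc u v a b).
    rewrite !lcZ lcN lcD lcZ -{1}(lc01 u v); congr lc; field; exact: D0.
  by rewrite memvZ // memvB // memvZ.
Qed.

Lemma mem_span2 (F : fieldType) (V : vectType F) (x y u : V) :
  u \in <<[:: x; y]>>%VS -> exists a b, u = lc x y a b.
Proof.
rewrite span_cons span_seq1 => /memv_addP[_ /vlineP[a ->]] [_ /vlineP[b ->] ->].
by exists a, b.
Qed.

Lemma lc_span2 (F : fieldType) (V : vectType F) (x y : V) a b :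
  lc x y a b \in <<[:: x; y]>>%VS.
Proof. by rewrite memvD // memvZ // memv_span // !inE eqxx ?orbT. Qed.

(** * Bases adapted to the centre *)

Definition central (F : fieldType) (A : leibnizType F) (w : A) : Prop :=
  forall a, br w a = 0 /\ br a w = 0.

Lemma central_lc (F : fieldType) (A : leibnizType F) (u v : A) a b :
  central u -> central v -> central (lc u v a b).
Proof.
move=> cu cv c; rewrite /lc brDl brDr !brZl !brZr.
by rewrite !(cu c).1 !(cu c).2 !(cv c).1 !(cv c).2 !scaler0 addr0.
Qed.

(** In dimension 4 a frame is a basis ([frame_basis]); stating only that it
spans lets changes of basis be checked without any independence argument. *)
Definition frame (F : fieldType) (A : leibnizType F) (e1 e2 w1 w2 : A) : Prop :=
  [/\ central w1, central w2 & <<[:: e1; e2; w1; w2]>>%VS = fullv].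

Lemma frame_lc (F : fieldType) (A : leibnizType F) (e1 e2 w1 w2 : A)
    a b c d k l m n :
  frame e1 e2 w1 w2 -> a * d - b * c != 0 -> k * n - l * m != 0 ->
  frame (lc e1 e2 a b) (lc e1 e2 c d) (lc w1 w2 k l) (lc w1 w2 m n).
Proof.
move=> [c1 c2 full] De Dw; split; [exact: central_lc | exact: central_lc |].
set X := [:: _; _; _; _].
have XP x : x \in X -> x \in <<X>>%VS by exact: memv_span.
have [e1X e2X] : e1 \in <<X>>%VS /\ e2 \in <<X>>%VS.
  by apply: mem_lc2 De _ _; apply: XP; rewrite !inE eqxx ?orbT.
have [w1X w2X] : w1 \in <<X>>%VS /\ w2 \in <<X>>%VS.
  by apply: mem_lc2 Dw _ _; apply: XP; rewrite !inE eqxx ?orbT.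
apply/eqP; rewrite eqEsubv subvf -full /=; apply/span_subvP => x.
by rewrite !inE => /or4P[] /eqP->.
Qed.

Lemma frame_dec (F : fieldType) (A : leibnizType F) (e1 e2 w1 w2 a : A) :
  frame e1 e2 w1 w2 -> exists s t z, central z /\ a = lc e1 e2 s t + z.
Proof.
move=> [c1 c2 full]; have : a \in fullv by rewrite memvf.
rewrite -full (span_cat [:: e1; e2] [:: w1; w2]).
move=> /memv_addP[_ /mem_span2[s [t ->]]] [_ /mem_span2[p [q ->]] ->].
by exists s, t, (lc w1 w2 p q); split=> //; exact: central_lc.
Qed.

Lemma frame_basis (F : fieldType) (A : leibnizType F) (e1 e2 w1 w2 : A) :
  \dim {:A} = 4%N -> frame e1 e2 w1 w2 ->
  basis_of fullv [tuple e1; e2; w1; w2].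
Proof. by move=> dimA [_ _ full]; rewrite basisEdim full subvv dimA. Qed.

(** * Recognizing an algebra from its table *)

Definition row_comb (F : fieldType) (V : lmodType F) (x1 x2 x3 x4 : V)
    (v : 'rV[F]_4) : V := \sum_(i < 4) v 0 i *: [tuple x1; x2; x3; x4]`_i.

Lemma row_comb_linear (F : fieldType) (V : lmodType F) (x1 x2 x3 x4 : V) :
  linear (row_comb x1 x2 x3 x4).
Proof.
move=> k u v; rewrite /row_comb scaler_sumr -big_split /=.
by apply: eq_bigr => i _; rewrite !mxE scalerDl scalerA.
Qed.

HB.instance Definition _ (F : fieldType) (V : lmodType F) (x1 x2 x3 x4 : V) :=
  GRing.isLinear.Build F 'rV[F]_4 V _ (row_comb x1 x2 x3 x4)
    (row_comb_linear x1 x2 x3 x4).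

Lemma row_comb_x (F : fieldType) (V : lmodType F) (x1 x2 x3 x4 : V) (k : 'I_4) :
  row_comb x1 x2 x3 x4 (x_ F k.+1) = [tuple x1; x2; x3; x4]`_k.
Proof.
rewrite /row_comb (bigD1 k) //= mxE eqxx scale1r big1 ?addr0 // => i nik.
by rewrite mxE eqSS (negPf (nik : (i : nat) != k)) scale0r.
Qed.

Lemma row_comb_x3 (F : fieldType) (V : lmodType F) (x1 x2 x3 x4 : V) :
  row_comb x1 x2 x3 x4 (x_ F 3) = x3.
Proof. exact: (row_comb_x _ _ _ _ (@Ordinal 4 2 isT)). Qed.

Lemma row_comb_x4 (F : fieldType) (V : lmodType F) (x1 x2 x3 x4 : V) :
  row_comb x1 x2 x3 x4 (x_ F 4) = x4.
Proof. exact: (row_comb_x _ _ _ _ (@Ordinal 4 3 isT)). Qed.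

(** The isomorphism is the coordinate map of the frame, with inverse
[row_comb].  Products that involve the two central vectors vanish on both
sides, which leaves four products to compare. *)
Lemma iso_of_frame (F : fieldType) (A : leibnizType F) (x1 x2 x3 x4 : A)
    (t : table F) (ht : tleibniz t) (r := row_comb x1 x2 x3 x4) :
  \dim {:A} = 4%N -> frame x1 x2 x3 x4 ->
  (forall i j, (2 < i)%N || (2 < j)%N -> t i j = 0) ->
  br x1 x1 = r (t 1 1)%N -> br x1 x2 = r (t 1 2)%N ->
  br x2 x1 = r (t 2 1)%N -> br x2 x2 = r (t 2 2)%N ->
  leib_iso A (table_alg ht).
Proof.
move=> dimA fx t0 h11 h12 h21 h22.
have bX := frame_basis dimA fx; have fX := basis_free bX.
pose X := [tuple x1; x2; x3; x4].
pose f (a : A) : 'rV[F]_4 := \row_i coord X i a.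
have rf a : r (f a) = a.
  rewrite {2}(coord_basis bX (memvf a)) /r /row_comb.
  by apply: eq_bigr => i _; rewrite mxE.
have fr v : f (r v) = v.
  by apply/rowP => i; rewrite mxE /r /row_comb coord_sum_free.
have f_lin : linear f by move=> k u v; apply/rowP => i; rewrite !mxE linearP.
have brX (i j : 'I_4) : br X`_i X`_j = r (t i.+1 j.+1).
  have [c3 c4 _] := fx.
  case: i j => [[|[|[|[|?]]]] //= ?] [[|[|[|[|?]]]] //= ?] //;
    rewrite ?(c3 _).1 ?(c3 _).2 ?(c4 _).1 ?(c4 _).2 //;
    by rewrite t0 ?orbT // /r linear0.
have br_suml (I : finType) (G : I -> A) b :
    br (\sum_i G i) b = \sum_i br (G i) b.
  by apply: (big_morph (br^~ b)) => [u v|]; rewrite ?brDl ?br0l.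
have br_sumr (I : finType) (G : I -> A) b :
    br b (\sum_i G i) = \sum_i br b (G i).
  by apply: (big_morph (br b)) => [u v|]; rewrite ?brDr ?br0r.
have f_br a b : f (br a b) = tmul t (f a) (f b).
  rewrite -[RHS]fr -{1}(rf a) -{1}(rf b); congr f.
  rewrite /tmul /r linear_sum {1}/row_comb br_suml; apply: eq_bigr => i _.
  rewrite linear_sum {1}/row_comb br_sumr; apply: eq_bigr => j _.
  by rewrite brZl brZr scalerA brX linearZ.
pose fl : {linear A -> table_alg ht} :=
  HB.pack (f : A -> table_alg ht)
    (GRing.isLinear.Build F A (table_alg ht) *:%R f f_lin).
by exists fl; split; [exists r|].
Qed.


(** * The two normal forms and their algebras *)

Definition classified (F : fieldType) (A : leibnizType F) : Prop :=
  leib_iso A (A14 F)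
  \/ leib_iso A (A15 F)
  \/ leib_iso A (A16 F)
  \/ (exists alpha : F,
        [/\ alpha <> -1, alpha <> 0 & leib_iso A (@A17 F alpha)])
  \/ (exists alpha : F, alpha <> -1 /\ leib_iso A (@A18 F alpha))
  \/ leib_iso A (A19 F).

Local Ltac table_zeros := by move=> [|[|[|?]]] [|[|[|?]]].

Local Ltac table_eq br_e w1 w2 :=
  rewrite /= ?(linear0, linearD, linearN, linearZ) /=
    ?(row_comb_x3, row_comb_x4) br_lc !br_e -?(lc00 w1 w2) !(lcZ, lcN, lcD);
  congr lc.

(** The second and third products make w2 equal to [e1, e2] + [e2, e1].  For
s = 0 the frame itself is that of the list, up to scaling w2 by a nonzero r.
For s <> 0 the new x2 = e1 + (r / s) e2 is chosen so that [e1, e2] becomes proportional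
to [x2, x2], and x1 = - e2 / s normalizes the factor. *)
Lemma classified_null_vector (F : fieldType) (A : leibnizType F)
    (e1 e2 w1 w2 : A) (s r : F) :
  \dim {:A} = 4%N -> frame e1 e2 w1 w2 ->
  br e1 e1 = lc w1 w2 1 0 -> br e1 e2 = lc w1 w2 s r ->
  br e2 e1 = lc w1 w2 (- s) (1 - r) -> br e2 e2 = lc w1 w2 0 0 ->
  classified A.
Proof.
move=> dimA fr h11 h12 h21 h22; have brE := (h11, h12, h21, h22).
have [s0 | s0] := eqVneq s 0; last first.
{ right; right; left.
  apply: (iso_of_frame _ dimA (frame_lc (a := 0) (b := - s^-1) (c := 1)
    (d := r / s) (k := -1) (l := - (r / s)) (m := 1) (n := (r - 1) / s) fr _ _)).
  - by rewrite mul0r sub0r mulr1 opprK invr_eq0.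
  - have -> : -1 * ((r - 1) / s) - - (r / s) * 1 = s^-1 by field.
    by rewrite invr_eq0.
  - table_zeros.
  all: by table_eq brE w1 w2; field. }
have [r0 | r0] := eqVneq r 0.
{ right; left.
  apply: (iso_of_frame _ dimA (frame_lc (a := 1) (b := 0) (c := 0)
    (d := 1) (k := 1) (l := 0) (m := 0) (n := 1) fr _ _)).
  - by rewrite mul1r mul0r subr0 oner_eq0.
  - by rewrite mul1r mul0r subr0 oner_eq0.
  - table_zeros.
  all: by table_eq brE w1 w2; rewrite ?s0 ?r0; ring. }
have Hx : frame (lc e1 e2 1 0) (lc e1 e2 0 1) (lc w1 w2 1 0) (lc w1 w2 0 r).
  by apply: frame_lc fr _ _; rewrite mul1r mul0r subr0 ?oner_eq0.
have [r1 | r1] := eqVneq r 1.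
{ left; apply: (iso_of_frame _ dimA Hx); first by table_zeros.
  all: by table_eq brE w1 w2; rewrite ?s0 ?r1; ring. }
right; right; right; left; exists ((1 - r) / r); split.
- move=> /(congr1 ( *%R^~ r)); rewrite divfK // mulN1r => /eqP.
  by rewrite subr_eq addNr oner_eq0.
- by apply/eqP; rewrite mulf_neq0 ?invr_eq0 // subr_eq0 eq_sym.
- apply: (iso_of_frame _ dimA Hx); first by table_zeros.
  all: by table_eq brE w1 w2; rewrite ?s0; field.
Qed.

(** The vectors x1 and x2 invert the search for an anticommuting pair in the
target algebra.  In A_18 such a pair is x2 + (1 + r) x1, x2 + (1 - r) x1 with
r^2 = 1 + alpha; for r = 2p + 1 it has the products below up to scalars, and
solving for x1, x2 gives, after multiplication by 2r, the frame used here.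
The construction needs r <> 0.  In A_19 the pair is
x2 + (-1 + i) x1, x2 + (-1 - i) x1, and it corresponds to p = -1/2. *)
Lemma classified_anticommuting (F : fieldType) (A : leibnizType F)
    (e1 e2 w1 w2 : A) (p : F) (i : F) :
  2 != 0 :> F -> i ^+ 2 = -1 ->
  \dim {:A} = 4%N -> frame e1 e2 w1 w2 ->
  br e1 e1 = lc w1 w2 1 0 -> br e1 e2 = lc w1 w2 p (p + 1) ->
  br e2 e1 = lc w1 w2 (- p) (- (p + 1)) -> br e2 e2 = lc w1 w2 0 1 ->
  classified A.
Proof.
move=> two0 ii dimA fr h11 h12 h21 h22; have brE := (h11, h12, h21, h22).
have [r0 | r0] := eqVneq (2 * p + 1) 0; last first.
{ right; right; right; right; left; exists (4 * p * (p + 1)); split.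
    move=> /eqP; rewrite -subr_eq0.
    have -> : 4 * p * (p + 1) - -1 = (2 * p + 1) ^+ 2 by ring.
    by rewrite expf_eq0 /= (negPf r0).
  apply: (iso_of_frame _ dimA (frame_lc (a := 1) (b := -1) (c := 2 * p)
    (d := 2 * (p + 1)) (k := 1) (l := 1) (m := - (2 * p) ^+ 2)
    (n := - (2 * (p + 1)) ^+ 2) fr _ _)).
  - have -> : 1 * (2 * (p + 1)) - -1 * (2 * p) = 2 * (2 * p + 1) by ring.
    by rewrite mulf_neq0.
  - have -> : 1 * (- (2 * (p + 1)) ^+ 2) - 1 * - (2 * p) ^+ 2 =
      - (2 ^+ 2 * (2 * p + 1)) by ring.
    by rewrite oppr_eq0 mulf_neq0 ?expf_neq0.
  - table_zeros.
  all: by table_eq brE w1 w2; ring. }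
have i0 : i != 0 by rewrite -sqrf_eq0 ii oppr_eq0 oner_eq0.
have p2 : p = - 2^-1.
  apply: (mulfI two0); rewrite mulrN divff //.
  by apply/eqP; rewrite -addr_eq0 r0.
do 5!right.
apply: (iso_of_frame _ dimA (frame_lc (a := 1) (b := -1) (c := 1 + i)
  (d := i - 1) (k := 1) (l := 1) (m := 2 * i) (n := - (2 * i)) fr _ _)).
- have -> : 1 * (i - 1) - -1 * (1 + i) = 2 * i by ring.
  by rewrite mulf_neq0.
- have -> : 1 * (- (2 * i)) - 1 * (2 * i) = - (2 ^+ 2 * i) by ring.
  by rewrite oppr_eq0 mulf_neq0 ?expf_neq0.
- table_zeros.
all: by table_eq brE w1 w2; rewrite p2; field : ii.
Qed.

(** The ideals are spanned by e1, w1 and by e2, w2. *)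
Lemma split_of_orthogonal_squares (F : fieldType) (A : leibnizType F)
    (e1 e2 w1 w2 : A) :
  \dim {:A} = 4%N -> frame e1 e2 w1 w2 ->
  br e1 e1 = w1 -> br e1 e2 = 0 -> br e2 e1 = 0 -> br e2 e2 = w2 ->
  split_alg A.
Proof.
move=> dimA fr h11 h12 h21 h22; have [c1 c2 full] := fr.
have frA := basis_free (frame_basis dimA fr).
have permX : perm_eq [:: e1; e2; w1; w2] ([:: e1; w1] ++ [:: e2; w2]).
  by rewrite /= perm_cons (perm_catCA [:: e2] [:: w1] [:: w2]).
exists <<[:: e1; w1]>>%VS, <<[:: e2; w2]>>%VS; split.
- move=> a _ /mem_span2[p [q ->]]; have [s [t [z [cz ->]]]] := frame_dec a fr.
  rewrite /lc !(brDl, brDr) !(brZl, brZr) h11 h12 h21 !(c1 _).1 !(c1 _).2.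
  rewrite !(cz _).1 !(cz _).2 !scaler0 !addr0 !scalerA.
  by split; apply/memvZ/memv_span; rewrite !inE eqxx orbT.
- move=> a _ /mem_span2[p [q ->]]; have [s [t [z [cz ->]]]] := frame_dec a fr.
  rewrite /lc !(brDl, brDr) !(brZl, brZr) h22 h12 h21 !(c2 _).1 !(c2 _).2.
  rewrite !(cz _).1 !(cz _).2 !scaler0 !addr0 !add0r !scalerA.
  by split; apply/memvZ/memv_span; rewrite !inE eqxx orbT.
- move=> U0; have : e1 != 0 by apply: free_not0 frA _; rewrite mem_head.
  by rewrite -memv0 -U0 memv_span // mem_head.
- move=> U0; have : e2 != 0.
    by apply: free_not0 frA _; rewrite !inE eqxx orbT.
  by rewrite -memv0 -U0 memv_span // mem_head.
- split; first by rewrite -span_cat -(eq_span (perm_mem permX)).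
  apply/directv_addP.
  by move: frA; rewrite (perm_free permX) cat_free => /and3P[].
Qed.

(** Replacing e2 by t e2 turns (p, q) into (t p, q / t), so the normalization
q = p + 1 amounts to a nonzero root t of p t^2 + t - q. *)
Lemma classified_anticommuting_nonsplit (F : fieldType) (A : leibnizType F)
    (e1 e2 w1 w2 : A) (p q : F) :
  (forall x : F, exists y, y ^+ 2 = x) -> 2 != 0 :> F ->
  \dim {:A} = 4%N -> ~ split_alg A -> frame e1 e2 w1 w2 ->
  br e1 e1 = w1 -> br e1 e2 = lc w1 w2 p q ->
  br e2 e1 = lc w1 w2 (- p) (- q) -> br e2 e2 = w2 ->
  classified A.
Proof.
move=> sqr two0 dimA nsplit fr h11 h12 h21 h22.
have [t [t0 tE]] : exists t, t != 0 /\ q = p * t ^+ 2 + t.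
  have [p0 | p0] := eqVneq p 0.
    have [q0 | q0] := eqVneq q 0; last by exists q; rewrite p0 mul0r add0r.
    case: nsplit; apply: split_of_orthogonal_squares dimA fr h11 _ _ h22.
      by rewrite h12 p0 q0 lc00.
    by rewrite h21 p0 q0 oppr0 lc00.
  have [q0 | q0] := eqVneq q 0.
    exists (- p^-1); rewrite oppr_eq0 invr_eq0 p0 q0; split=> //.
    by field.
  (* The root used is nonzero because q, the constant term, is nonzero. *)
  have [r rE] := sqr (1 + 4 * p * q).
  have qE : q = p * ((r - 1) / (2 * p)) ^+ 2 + (r - 1) / (2 * p).
    by field : rE; rewrite p0 two0.
  exists ((r - 1) / (2 * p)); split=> //; apply: contra_neq q0 => t0.
  by rewrite qE t0 expr0n mulr0 addr0.
have [i ii] := sqr (-1).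
have frt : frame (lc e1 e2 1 0) (lc e1 e2 0 t)
    (lc w1 w2 1 0) (lc w1 w2 0 (t ^+ 2)).
  by apply: frame_lc fr _ _; rewrite mul1r mul0r subr0 ?expf_neq0.
have brE : (br e1 e1 = lc w1 w2 1 0) * (br e1 e2 = lc w1 w2 p q) *
  (br e2 e1 = lc w1 w2 (- p) (- q)) * (br e2 e2 = lc w1 w2 0 1).
  by rewrite lc10 lc01.
have lc_lc k l : lc (lc w1 w2 1 0) (lc w1 w2 0 (t ^+ 2)) k l =
    lc w1 w2 k (l * t ^+ 2).
  by rewrite {1}/lc !lcZ lcD; congr lc; ring.
apply: (classified_anticommuting (p := t * p) two0 ii dimA frt).
all: by rewrite br_lc !brE lc_lc !(lcZ, lcD) tE; congr lc; ring.
Qed.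

(** * Reduction to a normal form *)

Definition generating (F : fieldType) (A : leibnizType F) (e1 e2 : A) : Prop :=
  (<<[:: e1; e2]>> + Leib A)%VS = fullv.

Lemma generating_lc (F : fieldType) (A : leibnizType F) (e1 e2 : A) a b c d :
  generating e1 e2 -> a * d - b * c != 0 ->
  generating (lc e1 e2 a b) (lc e1 e2 c d).
Proof.
move=> gen D0; pose Y := [:: lc e1 e2 a b; lc e1 e2 c d].
have [e1Y e2Y] : e1 \in <<Y>>%VS /\ e2 \in <<Y>>%VS.
  by apply: mem_lc2 D0 _ _; rewrite memv_span // !inE eqxx ?orbT.
apply/eqP; rewrite eqEsubv subvf -[X in (X <= _)%VS]gen; apply: addvS => //.
by apply/span_subvP => x; rewrite !inE => /orP[] /eqP->.
Qed.

Lemma br_lc_sq (F : fieldType) (A : leibnizType F) (u v : A) a b :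
  br (lc u v a b) (lc u v a b) =
  a ^+ 2 *: br u u + (a * b) *: (br u v + br v u) + b ^+ 2 *: br v v.
Proof. by rewrite br_lc scalerDr !addrA [b * a]mulrC. Qed.

Lemma br_lc_sym (F : fieldType) (A : leibnizType F) (u v : A) a b c d :
  br (lc u v a b) (lc u v c d) + br (lc u v c d) (lc u v a b) =
  (2 * (a * c)) *: br u u + (a * d + b * c) *: (br u v + br v u)
  + (2 * (b * d)) *: br v v.
Proof.
rewrite !br_lc !mulr2n !mulrDl !mul1r !scalerDr !scalerDl.
rewrite [c * a]mulrC [c * b]mulrC [d * a]mulrC [d * b]mulrC.
by rewrite (AC (4*4) ((1*5)*((2*6)*(7*3))*(4*8))).
Qed.

(** A change of basis acts on the relation as on the quadratic form
x S^2 + 2 y S T + z T^2, whose linear factors over x are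
x S + (y + r) T and x S + (y - r) T with r^2 = y^2 - x z.  Their coefficients
give u and v when r <> 0; when r = 0 the double factor gives v. *)
Lemma special_pair (F : fieldType) (A : leibnizType F) (e1 e2 : A) x y z :
  (forall x : F, exists y, y ^+ 2 = x) -> 2 != 0 :> F ->
  generating e1 e2 -> x != 0 ->
  x *: br e1 e1 + y *: (br e1 e2 + br e2 e1) + z *: br e2 e2 = 0 ->
  exists u v : A, generating u v /\ (br v v = 0 \/ br u v + br v u = 0).
Proof.
move=> sqr two0 gen x0 rel; have [r rE] := sqr (y ^+ 2 - x * z).
have [r0 | r0] := eqVneq r 0.
  exists (lc e1 e2 0 1), (lc e1 e2 x y); split.
    by apply: generating_lc => //; rewrite mul0r mul1r sub0r oppr_eq0.
  left; rewrite br_lc_sq.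
  have -> : y ^+ 2 = x * z.
    by apply/eqP; rewrite -subr_eq0 -rE r0 expr0n.
  by rewrite expr2 -!scalerA -!scalerDr rel scaler0.
exists (lc e1 e2 x (y + r)), (lc e1 e2 x (y - r)); split.
  apply: generating_lc => //.
  have -> : x * (y - r) - (y + r) * x = - (2 * x * r) by ring.
  by rewrite oppr_eq0 !mulf_neq0.
right; rewrite br_lc_sym.
have -> : x * (y - r) + (y + r) * x = 2 * x * y by ring.
have -> : 2 * ((y + r) * (y - r)) = 2 * x * z by ring : rE.
by rewrite mulrA -!scalerA -!scalerDr rel !scaler0.
Qed.

Lemma Leib_generating (F : fieldType) (A : leibnizType F) (e1 e2 : A) :
  (forall w, w \in Leib A -> central w) -> generating e1 e2 ->
  (Leib A <= <<[:: br e1 e1; (br e1 e2 + br e2 e1)%R; br e2 e2]>>)%VS.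
Proof.
move=> cL gen; apply: (vspanP _).2 => _ [a _ <-].
have : a \in fullv by rewrite memvf.
rewrite -gen => /memv_addP[_ /mem_span2[s [t ->]] [w /cL cw ->]].
rewrite brDl (cw _).1 addr0 brDr (cw _).2 addr0 br_lc_sq.
by rewrite !memvD // memvZ // memv_span // !inE eqxx ?orbT.
Qed.

(** Three vectors spanning the plane Leib A are dependent.  Solving the
relation for the first of them that depends on the later ones either gives a
nonzero coefficient on one of the two squares, as [special_pair] requires
(possibly after exchanging e1 and e2), or is already the conclusion. *)
Lemma exists_special_pair (F : fieldType) (A : leibnizType F) :
  (forall x : F, exists y, y ^+ 2 = x) -> 2 != 0 :> F ->
  \dim {:A} = 4%N -> \dim (Leib A) = 2%N ->
  (forall w, w \in Leib A -> central w) ->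
  (forall a b : A, br a b \in Leib A) ->
  exists u v : A, generating u v /\ (br v v = 0 \/ br u v + br v u = 0).
Proof.
move=> sqr two0 dimA dimL cL brL.
have [e1 [e2 gen]] : exists e1 e2 : A, generating e1 e2.
  have : \dim (Leib A)^C = 2%N by rewrite dimv_compl dimA dimL.
  have := span_basis (vbasisP (Leib A)^C); case: (vbasis _) => X /= + + dimC.
  rewrite dimC; case: X => [|e1 [|e2 [|]]] //= _ XE.
  by exists e1, e2; rewrite /generating XE addvC addv_complf.
set X := [tuple br e1 e1; (br e1 e2 + br e2 e1)%R; br e2 e2].
have spanX : <<X>>%VS = Leib A.
  apply/eqP; rewrite eqEsubv Leib_generating // andbT; apply/span_subvP => x.
  by rewrite !inE => /or3P[] /eqP->; rewrite ?memvD.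
have : ~~ free X by rewrite /free spanX dimL.
have genC : generating e2 e1.
  have := generating_lc (a := 0) (b := 1) (c := 1) (d := 0) gen.
  by rewrite lc10 lc01; apply; rewrite mul0r mul1r sub0r oppr_eq0 oner_eq0.
rewrite freeNE => /existsP[[[|[|[|]]] //= ?]].
- move=> /mem_span2[a [b h]].
  apply: (special_pair (x := 1) (y := - a) (z := - b) sqr two0 gen (oner_neq0 _)).
  by rewrite h /lc scale1r !scaleNr -addrA -opprD subrr.
- rewrite span_seq1 => /vlineP[a h]; have [a0 | a0] := eqVneq a 0.
    by exists e1, e2; split=> //; right; rewrite h a0 scale0r.
  apply: (special_pair (x := a) (y := -1) (z := 0) sqr two0 genC a0).
  by rewrite [br e2 e1 + _]addrC h scaleN1r subrr scale0r addr0.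
- by rewrite span_nil memv0 => /eqP h; exists e1, e2; split=> //; left.
Qed.

(** With respect to a special pair the three vectors spanning Leib A reduce to
two, and these complete the pair to a frame. *)
Lemma classification (F : fieldType) (A : leibnizType F) :
  (forall x : F, exists y, y ^+ 2 = x) -> 2 != 0 :> F ->
  \dim {:A} = 4%N -> ~ split_alg A -> \dim (Leib A) = 2%N ->
  (forall w, w \in Leib A -> central w) ->
  (forall a b : A, br a b \in Leib A) ->
  classified A.
Proof.
move=> sqr two0 dimA nsplit dimL cL brL.
have [e1 [e2 [gen special]]] := exists_special_pair sqr two0 dimA dimL cL brL.
have LeibS := Leib_generating cL gen.
have frameP w1 w2 : w1 \in Leib A -> w2 \in Leib A ->
    (Leib A <= <<[:: w1; w2]>>)%VS -> frame e1 e2 w1 w2.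
  move=> w1L w2L Lw; split; [exact: cL | exact: cL | apply/eqP].
  rewrite eqEsubv subvf (span_cat [:: e1; e2] [:: w1; w2]).
  by rewrite -[X in (X <= _)%VS]gen; apply: addvS.
case: special => [e22 | sym0].
- set w1 := br e1 e1; set w2 := br e1 e2 + br e2 e1.
  have Lw : (Leib A <= <<[:: w1; w2]>>)%VS.
    apply: subv_trans LeibS _; apply/span_subvP => x.
    rewrite !inE => /or3P[] /eqP->; rewrite ?e22 ?mem0v //;
    by rewrite memv_span // !inE eqxx ?orbT.
  have [s [r h12]] := mem_span2 (subvP Lw _ (brL e1 e2)).
  apply: (classified_null_vector (s := s) (r := r) dimA (frameP w1 w2 _ _ Lw)) => //.
  + exact: brL.
  + by rewrite /w2 memvD.
  + by rewrite lc10.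
  + have -> : br e2 e1 = w2 - br e1 e2 by rewrite /w2 addrC addKr.
    by rewrite h12 -{1}(lc01 w1 w2) lcN lcD add0r.
  + by rewrite lc00.
- set w1 := br e1 e1; set w2 := br e2 e2.
  have Lw : (Leib A <= <<[:: w1; w2]>>)%VS.
    apply: subv_trans LeibS _; apply/span_subvP => x.
    rewrite !inE => /or3P[] /eqP->; rewrite ?sym0 ?mem0v //;
    by rewrite memv_span // !inE eqxx ?orbT.
  have [p [q h12]] := mem_span2 (subvP Lw _ (brL e1 e2)).
  apply: (classified_anticommuting_nonsplit sqr two0 dimA nsplit
    (frameP w1 w2 _ _ Lw) erefl h12); [exact: brL | exact: brL | | by []].
  by rewrite -lcN -h12; apply/eqP; rewrite -addr_eq0 addrC sym0.
Qed.

(** * Over the complex numbers *)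

Theorem theorem2p5 (R : realType) (A : leibnizType R[i])
    (dimA : \dim {:A} = 4%N)
    (nonsplitA : ~ split_alg A)
    (nonLieA : non_Lie A)
    (nilA : nilpotent_alg A)
    (dimA2 : \dim (lpow A 2) = 2%N)
    (dimLeib : \dim (Leib A) = 2%N)
    (dimA3 : \dim (lpow A 3) = 0%N) :
  leib_iso A (A14 R[i])
  \/ leib_iso A (A15 R[i])
  \/ leib_iso A (A16 R[i])
  \/ (exists alpha : R[i],
        [/\ alpha <> -1, alpha <> 0 & leib_iso A (@A17 R[i] alpha)])
  \/ (exists alpha : R[i], alpha <> -1 /\ leib_iso A (@A18 R[i] alpha))
  \/ leib_iso A (A19 R[i]).
Proof.
have mem_br (U V : {vspace A}) a b : a \in U -> b \in V -> br a b \in br_vs U V.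
  by move=> Ua Vb; apply: (vspanP _).1; exists a, b.
have br_A2 a b : br a b \in lpow A 2 by rewrite mem_br ?memvf.
have LeibE : Leib A = lpow A 2.
  apply/eqP; rewrite eqEdim dimA2 dimLeib leqnn andbT.
  by apply: (vspanP _).2 => _ [a _ <-].
have rann (w a : A) : w \in lpow A 2 -> br a w = 0.
  move=> wA2; apply/eqP; rewrite -memv0.
  have <- : lpow A 3 = 0%VS by apply/eqP; rewrite -dimv_eq0 dimA3.
  by rewrite [lpow A 3]/(br_vs fullv (lpow A 2)) mem_br ?memvf.
apply: classification => //.
- by move=> x; exists (sqrtC x); rewrite sqrtCK.
- by rewrite pnatr_eq0.
- move=> w; rewrite LeibE => wA2 a; split; last exact: rann.
  pose f : {linear A -> A} := HB.pack (br^~ a)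
    (GRing.isLinear.Build _ A A *:%R (br^~ a) ((@br_bilinear _ A).1 a)).
  suff /subvP/(_ w wA2) : (lpow A 2 <= lker (linfun f))%VS.
    by rewrite memv_ker lfunE => /eqP.
  apply: (vspanP _).2 => _ [b [c [_ _ ->]]]; rewrite memv_ker lfunE /=.
  (* [[b, c], a] = [b, [c, a]] - [c, [b, a]], both terms lying in A^3. *)
  have := br_leibniz b c a.
  by rewrite (rann (br c a)) // (rann (br b a)) // addr0 => <-.
- by rewrite LeibE.
Qed.
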